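(* Let $(\Omega,\mathcal F,(\mathcal F_t)_{t\in\mathbb N_0})$ be a filtered measurable space and $\mathcal P$ a family of probability measures on $(\Omega,\mathcal F)$. Let $(\alpha_k)_{k\ge1}$ be a decreasing sequence in $(0,1)$ with $\alpha_k\downarrow0$, and for each $k$ let $\tau_k$ be an $(\mathcal F_t)$-stopping time with values in $\mathbb N_0\cup\{\infty\}$ such that $\sup_{P\in\mathcal P}P(\tau_k<\infty)\le\alpha_k$. Let $(w_k)_{k\ge1}$ be nonnegative weights, not all zero, with $\sum_{k=1}^\infty w_k\alpha_k\le1$. Then the process $$M_t:=\sum_{k=1}^\infty w_k\mathbf 1_{\{\tau_k\le t\}},\qquad t\in\mathbb N_0,$$ is nondecreasing in $t$ and is a $\mathcal P$-$e$-process.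
   Context: A nonnegative adapted process $M=(M_t)_{t\in\mathbb N_0}$ (values in $[0,\infty]$ allowed) is a $\mathcal P$-$e$-process if $\mathbb E_P[M_\sigma]\le1$ for every $P\in\mathcal P$ and every finite $(\mathcal F_t)$-stopping time $\sigma$. Here $\mathbb N_0=\{0,1,2,\dots\}$. *)

(* Defs.v *)
From HB Require Import structures.
From mathcomp Require Import all_boot all_order all_algebra.
From mathcomp Require Import all_classical all_reals all_analysis.
From mathcomp Require Import measurable_realfun.
Set Implicit Arguments.
Unset Strict Implicit.
Unset Printing Implicit Defensive.
Import Order.TTheory GRing.Theory Num.Theory.
Import numFieldNormedType.Exports.
Local Open Scope classical_set_scope.
Local Open Scope ring_scope.

(* Extended times in {0, 1, 2, ...} U {oo}: [None] is oo. *)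
Definition xtime := option nat.

Definition xtime_le (s : xtime) (t : nat) : bool :=
  if s is Some n then (n <= t)%N else false.

Definition xtime_finite (s : xtime) : bool := isSome s.

Record is_filtration (d : measure_display) (T : measurableType d)
    (F : nat -> set (set T)) : Prop := {
  filtration_sigma_algebra : forall t, sigma_algebra [set: T] (F t) ;
  filtration_measurable : forall t, F t `<=` measurable ;
  filtration_nondecreasing : forall s t, (s <= t)%N -> F s `<=` F t }.

Definition is_stopping_time (T : Type) (F : nat -> set (set T))
    (tau : T -> xtime) : Prop :=
  forall t : nat, F t [set x | xtime_le (tau x) t].

(* [g_sigma_algebraType (F t)] is [T] with the sigma-algebra generated by
   [F t], which is [F t] itself when [F] is a filtration. *)
Definition adapted (d : measure_display) (T : measurableType d) (R : realType)
    (F : nat -> set (set T)) (M : nat -> T -> \bar R) : Prop :=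
  forall t, measurable_fun [set: g_sigma_algebraType (F t)] (M t).

(* Processes may take the value +oo, hence the integral in place of the
   library's expectation, which is restricted to real-valued functions.
   Finite stopping times take values in [nat]. *)
Record is_e_process (d : measure_display) (T : measurableType d)
    (R : realType) (F : nat -> set (set T)) (PP : set (probability T R))
    (M : nat -> T -> \bar R) : Prop := {
  e_process_ge0 : forall t x, (0 <= M t x)%E ;
  e_process_adapted : adapted F M ;
  e_process_le1 : forall P : probability T R, PP P ->
    forall sigma : T -> nat, is_stopping_time F (fun x => Some (sigma x)) ->
    (\int[P]_x M (sigma x) x <= 1)%E }.

(* Main.v *)
(* For a finite stopping time sigma, M_sigma is the sum over k of
   w_k 1{tau_k <= sigma}, and {tau_k <= sigma} is contained in
   {tau_k < oo}.  Integrating term by term (the terms are nonnegative) gives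
   E_P[M_sigma] <= sum w_k P(tau_k < oo) <= sum w_k alpha_k <= 1. *)
Require Import Defs.
From mathcomp Require Import all_boot all_order all_algebra.
From mathcomp Require Import all_classical all_reals all_analysis.
From mathcomp Require Import measurable_realfun.
Import Order.TTheory GRing.Theory Num.Theory.
Import numFieldNormedType.Exports.
Local Open Scope classical_set_scope.
Local Open Scope ring_scope.

Section WeightedIndicatorSeries.
Context {d : measure_display} {T : measurableType d} {R : realType}.
Variables (N : nat) (w : nat -> R) (A : nat -> set T).
Hypothesis w_ge0 : forall k, (N <= k)%N -> 0 <= w k.
Hypothesis mA : forall k, (N <= k)%N -> measurable (A k).

Let term_ge0 k x : (N <= k)%N -> (0 <= (w k * \1_(A k) x)%:E)%E.
Proof. by move=> Nk; rewrite lee_fin mulr_ge0 ?w_ge0. Qed.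

Let measurable_term k :
  (N <= k)%N -> measurable_fun setT (fun x => (w k * \1_(A k) x)%:E).
Proof.
move=> Nk; apply/measurable_EFinP/measurable_funM; first exact: measurable_cst.
exact: measurable_indic (mA _ Nk).
Qed.

(** A countable sum of nonnegative measurable functions is measurable. The measurable type is kept
    arbitrary so that the lemma also applies to [T] with the sigma-algebra of [F t], which gives
    adaptedness. *)
Lemma measurable_series_indic :
  measurable_fun setT (fun x => (\sum_(N <= k <oo) (w k * \1_(A k) x)%:E)%E).
Proof.
under eq_fun do rewrite eseries_cond.
by apply: (@ge0_emeasurable_sum _ _ _ _ _ (fun k => true && (N <= k)%N))
  => [k x _|k]; [exact: term_ge0|exact: measurable_term].
Qed.

(** Monotone convergence: since the terms are nonnegative, sum and integral can be exchanged even
    when the total is infinite. *)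
Lemma integral_series_indic (mu : {measure set T -> \bar R}) :
  (\int[mu]_x (\sum_(N <= k <oo) (w k * \1_(A k) x)%:E)
   = \sum_(N <= k <oo) (w k)%:E * mu (A k))%E.
Proof.
(* Nothing is assumed on [w] and [A] below [N], so those terms are replaced by 0; then every term is
   measurable and nonnegative. *)
under eq_integral do rewrite eseries_cond eseries_mkcond.
rewrite integral_nneseries//; last 2 first.
- move=> k /=; have [Nk|_] := boolP (N <= k)%N; last exact: measurable_cst.
  exact: measurable_term.
- by move=> k x _; case: ifPn => // Nk; exact: term_ge0.
rewrite [RHS]eseries_cond [RHS]eseries_mkcond.
apply: eq_eseriesr => k _ /=.
have [Nk|_] := boolP (N <= k)%N; last exact: integral0.
under eq_integral do rewrite EFinM.
rewrite ge0_integralZl_EFin//; last 2 first.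
- by apply/measurable_EFinP; exact: measurable_indic (mA _ Nk).
- exact: w_ge0.
by rewrite integral_indic ?setIT//; exact: mA.
Qed.

End WeightedIndicatorSeries.

Section StoppingTimes.
Context {d : measure_display} {T : measurableType d} {F : nat -> set (set T)}.
Hypothesis hF : is_filtration F.

Lemma stopping_time_measurable_le {tau : T -> xtime} (t : nat) :
  is_stopping_time F tau -> measurable [set x | xtime_le (tau x) t].
Proof. by move=> /(_ t); exact: filtration_measurable hF _ _. Qed.

Lemma stopping_time_measurable_finite {tau : T -> xtime} :
  is_stopping_time F tau -> measurable [set x | xtime_finite (tau x)].
Proof.
move=> tauF.
rewrite (_ : mkset _ = \bigcup_t [set x | xtime_le (tau x) t]).
  by apply: bigcupT_measurable => t; exact: stopping_time_measurable_le.
apply/seteqP; split=> [x /=|x [t _] /=]; last by case: (tau x).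
by case tauE: (tau x) => [n|//] _; exists n; rewrite //= tauE /=.
Qed.

(* The complement {sigma < tau} is the union over t of
   {sigma <= t} minus {tau <= t}. *)
Lemma stopping_time_measurable_le_stopping {tau : T -> xtime} {sigma : T -> nat} :
  is_stopping_time F tau -> is_stopping_time F (fun x => Some (sigma x)) ->
  measurable [set x | xtime_le (tau x) (sigma x)].
Proof.
move=> tauF sigmaF.
rewrite (_ : mkset _ = ~` \bigcup_t ([set x | xtime_le (Some (sigma x)) t] `\`
    [set x | xtime_le (tau x) t])).
  apply/measurableC/bigcupT_measurable => t.
  by apply: measurableD; exact: stopping_time_measurable_le.
apply/seteqP; split=> [x /= tau_sigma [t _ [/= sigmat]]|x /= ntau].
  apply; move: tau_sigma; case: (tau x) => //= n n_sigma.
  exact: leq_trans n_sigma sigmat.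
apply: contrapT => tauN; apply: ntau.
(* If [sigma x < tau x], the time [t = sigma x] itself separates the two. *)
by exists (sigma x) => //; split => /=.
Qed.

End StoppingTimes.

(* Sequences indexed by k >= 1 are functions on nat whose value at 0 is
   unconstrained and unused. *)
Theorem proposition2p4 (R : realType) (d : measure_display)
    (T : measurableType d) (F : nat -> set (set T)) (hF : is_filtration F)
    (PP : set (probability T R))
    (alpha : nat -> R)
    (alpha01 : forall k, (1 <= k)%N -> 0 < alpha k < 1)
    (alpha_dec : forall j k, (1 <= j)%N -> (j <= k)%N -> alpha k <= alpha j)
    (alpha_cvg : alpha @ \oo --> (0 : R))
    (tau : nat -> T -> xtime)
    (tau_stop : forall k, (1 <= k)%N -> is_stopping_time F (tau k))
    (tau_alpha : forall k, (1 <= k)%N ->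
      (ereal_sup [set P [set x | xtime_finite (tau k x)] | P in PP]
        <= (alpha k)%:E)%E)
    (w : nat -> R)
    (w_ge0 : forall k, (1 <= k)%N -> 0 <= w k)
    (w_neq0 : exists k, (1 <= k)%N /\ w k <> 0)
    (w_alpha : (\sum_(1 <= k <oo) (w k * alpha k)%:E <= 1)%E) :
  let M : nat -> T -> \bar R := fun t x =>
    (\sum_(1 <= k <oo) (w k * \1_[set y | xtime_le (tau k y) t] x)%:E)%E in
  (forall x, {homo (fun t => M t x) : s t / (s <= t)%N >-> (s <= t)%E}) /\
  is_e_process F PP M.
Proof.
have term_ge0 k (A : set T) x : (1 <= k)%N -> (0 <= (w k * \1_A x)%:E)%E.
  by move=> k1; rewrite lee_fin mulr_ge0 ?w_ge0.
have series_le (A B : nat -> set T) x : (forall k, A k x -> B k x) ->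
    (\sum_(1 <= k <oo) (w k * \1_(A k) x)%:E <=
     \sum_(1 <= k <oo) (w k * \1_(B k) x)%:E)%E.
  move=> AB; rewrite eseries_cond [leRHS]eseries_cond.
  apply: lee_nneseries => [k _|k] k1; first exact: term_ge0.
  rewrite lee_fin ler_wpM2l ?w_ge0// !indicE ler_nat.
  (* Outside [A k] the left indicator is 0; inside, both indicators are 1. *)
  by case: (boolP (x \in A k)) => // /set_mem/AB/mem_set ->.
move=> M; split=> [x s t st|].
  apply: series_le => k /=; case: (tau k x) => //= n ns.
  exact: leq_trans ns st.
split=> [t x|t|P PPP sigma sigmaF].
- by apply: nneseries_ge0 => k k1 _; exact: term_ge0.
(* Measurability is needed for the sigma-algebra at time [t], not the ambient one; the events {tau_k
   <= t} belong to [F t] by the stopping time property. *)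
- apply: (@measurable_series_indic _ (g_sigma_algebraType (F t))) => // k k1.
  by apply: sub_gen_smallest; exact: tau_stop.
- have m_le k : (1 <= k)%N -> measurable [set x | xtime_le (tau k x) (sigma x)].
    move=> k1.
    exact (stopping_time_measurable_le_stopping hF (tau_stop k k1) sigmaF).
  (* In [M (sigma x) x] the event {y : tau_k y <= sigma x} varies with [x], but at the point [x] its
     indicator agrees with that of the fixed event {y : tau_k y <= sigma y}. *)
  rewrite [leLHS](integral_series_indic _ _ _ w_ge0 m_le P).
  apply: le_trans w_alpha; rewrite eseries_cond [leRHS]eseries_cond.
  apply: lee_nneseries => [k _|k] k1.
    by rewrite mule_ge0// lee_fin w_ge0.
  rewrite EFinM lee_wpmul2l ?lee_fin ?w_ge0//.
  (* As [sigma] is finite, tau_k <= sigma forces tau_k < oo, whose probability is at most the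
     supremum over [PP]. *)
  apply: (@le_trans _ _ (P [set x | xtime_finite (tau k x)])).
    apply: le_measure; rewrite ?inE.
    + exact: m_le.
    + exact (stopping_time_measurable_finite hF (tau_stop k k1)).
    + by move=> x /=; case: (tau k x).
  by apply: le_trans (tau_alpha k k1); apply: ereal_sup_ubound; exists P.
Qed.
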